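(* Let $u, v : [a,b] \to \mathbb{R}$ be continuous and let $p, q : [a,b] \to \mathbb{R}$ be continuous functions with \[ u(x) - u(a) = \int_a^x p(t)\,dt, \qquad v(x) - v(a) = \int_a^x q(t)\,dt \] for every $x \in [a,b]$. Then \[ \int_a^b p(t)\,v(t)\,dt + \int_a^b u(t)\,q(t)\,dt = u(b)v(b) - u(a)v(a). \]
   Context: Integrals are Riemann integrals. *)

(* Defs.v *)
From Stdlib Require Export Reals.
From Coquelicot Require Export Coquelicot.

Open Scope R_scope.

(** A function on [a,b] is represented by a function on [R] of which only the
    values on [a,b] matter; hence continuity is relative to [a,b], and says
    nothing about the behaviour outside, not even at the endpoints. *)
Definition continuous_on_segment (a b : R) (f : R -> R) : Prop :=
  continuous_on (fun x : R => a <= x <= b) f.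

(* Main.v *)
(** Clamping the argument to [[a, b]] extends the data to continuous functions
    on the whole line without changing any integral over a subinterval of
    [[a, b]].  The extended primitives are then differentiable everywhere, and
    the claim is the fundamental theorem of calculus for their product. *)
Require Import Defs.
From Stdlib Require Import Reals Lra.
From Coquelicot Require Import Coquelicot.
Open Scope R_scope.

Definition clamp (a b x : R) : R := Rmax a (Rmin b x).

Lemma clamp_in (a b x : R) : a <= b -> a <= clamp a b x <= b.
Proof.
  intros hab; unfold clamp, Rmax, Rmin.
  destruct (Rle_dec b x); destruct (Rle_dec a _); lra.
Qed.

Lemma clamp_id (a b x : R) : a <= x <= b -> clamp a b x = x.
Proof.
  intros hx; unfold clamp.
  rewrite Rmin_right by lra; apply Rmax_right; lra.
Qed.

(** Serves to transfer neighbourhoods through [clamp] without changing their radius. *)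
Lemma clamp_lipschitz (a b x y : R) :
  Rabs (clamp a b y - clamp a b x) <= Rabs (y - x).
Proof.
  unfold clamp, Rmax, Rmin.
  destruct (Rle_dec b x); destruct (Rle_dec b y);
    repeat destruct (Rle_dec a _); unfold Rabs;
    repeat destruct (Rcase_abs _); lra.
Qed.

(** [clamp] is continuous with values in the segment, so continuity of [f] relative to the segment
    is enough for the composite, even at and beyond the endpoints. *)
Lemma continuous_clamp (a b : R) (f : R -> R) (x : R) :
  a <= b -> continuous_on_segment a b f ->
  continuous (fun y => f (clamp a b y)) x.
Proof.
  intros hab hf.
  apply (filterlim_comp _ _ _ (clamp a b) f (locally x)
    (within (fun y => a <= y <= b) (locally (clamp a b x)))).
  (* The same radius [e] works, since [clamp] is 1-Lipschitz; the restriction imposed by [within]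
     holds by [clamp_in]. *)
  - intros P [e He]; exists e; intros y Hy.
    apply He; [|apply clamp_in; exact hab].
    apply Rle_lt_trans with (1 := clamp_lipschitz a b x y); exact Hy.
  - apply hf, clamp_in, hab.
Qed.

Lemma ex_RInt_continuous_everywhere (f : R -> R) (a b : R) :
  (forall x, continuous f x) -> ex_RInt f a b.
Proof.
  intros hf; apply (ex_RInt_continuous (V := R_CompleteNormedModule)).
  intros x _; apply hf.
Qed.

Lemma is_derive_primitive (f : R -> R) (a c x : R) :
  (forall y, continuous f y) ->
  is_derive (fun y => c + RInt f a y) x (f x).
Proof.
  (* The added [0] is the derivative of the constant [c], as the sum rule expects. *)
  intros hf; rewrite <- (Rplus_0_l (f x)).
  apply (is_derive_plus (V := R_NormedModule)).
  - apply (is_derive_const (V := R_NormedModule)).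
  - apply is_derive_RInt with a; [|apply hf].
    apply filter_forall; intros y.
    apply (RInt_correct (V := R_CompleteNormedModule)), ex_RInt_continuous_everywhere, hf.
Qed.

(** By the product rule the sum of the two integrands is the derivative of [U * V], and it is
    continuous, so the fundamental theorem of calculus applies. *)
Lemma RInt_by_parts (a b : R) (U V P Q : R -> R) :
  (forall x, is_derive U x (P x)) -> (forall x, is_derive V x (Q x)) ->
  (forall x, continuous P x) -> (forall x, continuous Q x) ->
  RInt (fun t => P t * V t) a b + RInt (fun t => U t * Q t) a b
  = U b * V b - U a * V a.
Proof.
  intros dU dV cP cQ.
  assert (cU : forall x, continuous U x).
  { intros x; apply (ex_derive_continuous (V := R_NormedModule)).
    exists (P x); apply dU. }
  assert (cV : forall x, continuous V x).
  { intros x; apply (ex_derive_continuous (V := R_NormedModule)).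
    exists (Q x); apply dV. }
  assert (cPV : forall x, continuous (fun t => P t * V t) x).
  { intros x; apply (continuous_mult (K := R_AbsRing)); [apply cP|apply cV]. }
  assert (cUQ : forall x, continuous (fun t => U t * Q t) x).
  { intros x; apply (continuous_mult (K := R_AbsRing)); [apply cU|apply cQ]. }
  transitivity (RInt (fun t => P t * V t + U t * Q t) a b).
  { symmetry; apply (RInt_plus (V := R_CompleteNormedModule));
      apply ex_RInt_continuous_everywhere; assumption. }
  apply is_RInt_unique.
  apply (is_RInt_derive (V := R_CompleteNormedModule) (fun t => U t * V t)).
  - intros x _; apply (is_derive_mult (K := R_AbsRing)); [apply dU|apply dV|].
    (* The product rule is stated over a general ring and asks for commutativity. *)
    intros n m; apply Rmult_comm.
  - intros x _; apply (continuous_plus (V := R_NormedModule)); auto.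
Qed.

Lemma RInt_clamp (a b x : R) (f : R -> R) :
  a <= x <= b -> RInt (fun t => f (clamp a b t)) a x = RInt f a x.
Proof.
  intros hx; apply RInt_ext; intros t.
  rewrite Rmin_left, Rmax_right by lra; intros ht.
  rewrite clamp_id by lra; reflexivity.
Qed.

Theorem theorem4p2 (a b : R) (hab : a <= b) (u v p q : R -> R)
  (hu : continuous_on_segment a b u) (hv : continuous_on_segment a b v)
  (hp : continuous_on_segment a b p) (hq : continuous_on_segment a b q)
  (hup : forall x : R, a <= x <= b -> u x - u a = RInt p a x)
  (hvq : forall x : R, a <= x <= b -> v x - v a = RInt q a x) :
  RInt (fun t : R => p t * v t) a b + RInt (fun t : R => u t * q t) a b
  = u b * v b - u a * v a.
Proof.
  set (P := fun t => p (clamp a b t)).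
  set (Q := fun t => q (clamp a b t)).
  set (U := fun x => u a + RInt P a x).
  set (V := fun x => v a + RInt Q a x).
  assert (cP : forall x, continuous P x)
    by (intros x; apply continuous_clamp; assumption).
  assert (cQ : forall x, continuous Q x)
    by (intros x; apply continuous_clamp; assumption).
  assert (eU : forall x, a <= x <= b -> U x = u x).
  { intros x hx; unfold U, P; rewrite RInt_clamp, <- hup by assumption; ring. }
  assert (eV : forall x, a <= x <= b -> V x = v x).
  { intros x hx; unfold V, Q; rewrite RInt_clamp, <- hvq by assumption; ring. }
  (* Both endpoints lie in the segment, so the boundary terms pass to the extensions. *)
  rewrite <- (eU a), <- (eU b), <- (eV a), <- (eV b) by lra.
  rewrite <- (RInt_by_parts a b U V P Q);
    [|intros x; apply is_derive_primitive; assumption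
     |intros x; apply is_derive_primitive; assumption
     |assumption|assumption].
  (* Integrands are compared only strictly between [a] and [b], where [clamp] is the identity and
     [U], [V] agree with [u], [v]. *)
  f_equal; apply RInt_ext; intros t;
    rewrite Rmin_left, Rmax_right by lra; intros ht; unfold P, Q;
    rewrite clamp_id by lra; rewrite ?eU, ?eV by lra; reflexivity.
Qed.
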